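(* Let $\xi$ be a real smooth vector bundle over a differentiable manifold $M$ and let $\nabla$ be a pseudoconnection of $\xi$ with principal homomorphism $P\in HOM(\xi,\xi)$. Then for all smooth vector fields $X,Y$ on $M$ and all $s\in\Omega^0(\xi)$, $$F^\nabla_{X,Y}(s)=\nabla_X\nabla_Y(Ps)-\nabla_Y\nabla_X(Ps)-\nabla_XP(\nabla_Ys)+P\nabla_X\nabla_Ys+\nabla_YP(\nabla_Xs)-P\nabla_Y\nabla_Xs-P\left(\nabla_{[X,Y]}P(s)\right).$$
   Context: $\Omega^0(M)$ is the ring of $C^\infty$ real-valued functions on $M$, $\Omega^k(M)$ the $\Omega^0(M)$-module of smooth $k$-forms, $d$ the standard exterior derivative. For a real smooth vector bundle $\xi$ over $M$, $\Omega^0(\xi)$ is the $\Omega^0(M)$-module of smooth sections of $\xi$, and $\Omega^k(\xi)=\Omega^k(M)\otimes_{\Omega^0(M)}\Omega^0(\xi)$ for $k\ge 1$. $HOM(\xi,\xi)$ is the set of bundle homomorphisms $\xi\to\xi$ over the identity of $M$; each $P\in HOM(\xi,\xi)$ acts on sections and on $\Omega^k(\xi)$ by $P(\omega\otimes s)=\omega\otimes P(s)$. The product $\wedge:\Omega^k(M)\times\Omega^l(\xi)\to\Omega^{k+l}(\xi)$ is given on generators by $\beta\wedge(\omega\otimes s)=(\beta\wedge\omega)\otimes s$. Conventions for $1$-forms $\omega,\tau$: $(\omega\wedge\tau)(X,Y)=\omega(X)\tau(Y)-\omega(Y)\tau(X)$ and $d\omega(X,Y)=X(\omega(Y))-Y(\omega(X))-\omega([X,Y])$.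 A pseudoconnection of $\xi$ with principal homomorphism $P\in HOM(\xi,\xi)$ is an $\mathbb{R}$-linear map $\nabla:\Omega^0(\xi)\to\Omega^1(\xi)$ such that $\nabla(f\cdot s)=df\otimes P(s)+f\cdot\nabla(s)$ for all $f\in\Omega^0(M)$, $s\in\Omega^0(\xi)$. Its exterior derivative is the sequence of $\mathbb{R}$-linear maps $d^\nabla:\Omega^k(\xi)\to\Omega^{k+1}(\xi)$, $k\ge0$, with $d^\nabla=\nabla$ for $k=0$, determined on generators by $d^\nabla(\omega\otimes s)=d\omega\otimes P(s)+(-1)^k\omega\wedge\nabla s$ for $\omega\in\Omega^k(M)$, $s\in\Omega^0(\xi)$. The curvature form of $\nabla$ is $F^\nabla=P\circ d^\nabla\circ\nabla-d^\nabla\circ P\circ\nabla+d^\nabla\circ\nabla\circ P:\Omega^0(\xi)\to\Omega^2(\xi)$. For smooth vector fields $X_1,\dots,X_k$ on $M$, the evaluation map $Ev_{X_1,\dots,X_k}:\Omega^k(\xi)\to\Omega^0(\xi)$ is defined on generators by $Ev_{X_1,\dots,X_k}(\omega\otimes s)=\omega(X_1,\dots,X_k)\cdot s$. Define $\nabla_X:\Omega^0(\xi)\to\Omega^0(\xi)$ by $\nabla_Xs=Ev_X(\nabla s)$ and $F^\nabla_{X,Y}:\Omega^0(\xi)\to\Omega^0(\xi)$ by $F^\nabla_{X,Y}(s)=Ev_{X,Y}(F^\nabla(s))$. *)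

(* Defs.v *)
From HB Require Import structures.
From mathcomp Require Import all_boot all_order all_algebra.
From mathcomp Require Import all_classical all_reals all_analysis.
From mathcomp Require Import ring.

Set Implicit Arguments.
Unset Strict Implicit.
Unset Printing Implicit Defensive.

Import Order.TTheory GRing.Theory Num.Theory.
Import numFieldNormedType.Exports.

Local Open Scope classical_set_scope.
Local Open Scope ring_scope.
Local Open Scope quotient_scope.

Section EuclideanSmoothness.
Context {R : realType} {n : nat}.
Implicit Types (U : set 'rV[R]_n) (f g : 'rV[R]_n -> R).

Fixpoint Ck_on (k : nat) U f : Prop :=
  (forall x, U x -> {for x, continuous f}) /\
  if k is k'.+1 then
    forall i : 'I_n,
      (forall x, U x -> derivable f x (delta_mx 0 i)) /\
      Ck_on k' U (fun x => 'D_(delta_mx 0 i) f x)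
  else True.

Definition Cinfty_on U f : Prop := forall k, Ck_on k U f.

Lemma Ck_on_cont k U f x : Ck_on k U f -> U x -> {for x, continuous f}.
Proof. by case: k => [|k] [] cf _; exact: cf. Qed.

Lemma Ck_on_pred k U f : Ck_on k.+1 U f -> Ck_on k U f.
Proof.
elim: k f => [|k IHk] f; first by move=> [cf _]; split.
move=> [cf df]; split => // i; have [dfi Ckf] := df i.
by split => //; exact: IHk.
Qed.

Lemma Ck_on_eq k U f g : open U -> (forall x, U x -> f x = g x) ->
  Ck_on k U f -> Ck_on k U g.
Proof.
move=> oU.
have near_fg (h1 h2 : 'rV[R]_n -> R) x : (forall y, U y -> h1 y = h2 y) -> U x ->
    {near x, h1 =1 h2}.
  by move=> h12 Ux; apply: filterS (open_nbhs_nbhs (conj oU Ux)); exact: h12.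
have cont_fg (h1 h2 : 'rV[R]_n -> R) : (forall y, U y -> h1 y = h2 y) ->
    (forall x, U x -> {for x, continuous h1}) ->
    forall x, U x -> {for x, continuous h2}.
  move=> h12 ch1 x Ux; rewrite /prop_for /continuous_at -(h12 x Ux).
  exact: cvg_trans (@near_eq_cvg _ _ (nbhs x) _ _ _ (near_fg h1 h2 x h12 Ux))
    (ch1 x Ux).
elim: k f g => [|k IHk] f g fg [cf df].
  by split; [exact: (cont_fg f)|].
split; first exact: (cont_fg f).
have nfg x := near_fg f g x fg.
move=> i; have [dfi Ckf] := df i; split.
  by move=> x Ux; exact: near_eq_derivable (nfg x Ux) (dfi x Ux).
apply: IHk Ckf => x Ux; exact: near_eq_derive (nfg x Ux).
Qed.

Lemma Ck_onW k U V f : V `<=` U -> Ck_on k U f -> Ck_on k V f.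
Proof.
move=> VU; elim: k f => [|k IHk] f [cf df]; split=> //.
- by move=> x /VU; exact: cf.
- by move=> x /VU; exact: cf.
- move=> i; have [dfi Cdf] := df i; split; last exact: IHk.
  by move=> x /VU; exact: dfi.
Qed.

Lemma Ck_on_cst k U (c : R) : open U -> Ck_on k U (fun=> c).
Proof.
move=> oU; elim: k c => [|k IHk] c.
  by split => // x _; exact: cst_continuous.
split; first by move=> x _; exact: cst_continuous.
move=> i; split; first by move=> x _; exact: derivable_cst.
apply: (@Ck_on_eq _ _ (fun=> 0)) => // x _.
by rewrite derive_cst.
Qed.

Lemma Ck_onD k U f g : open U -> Ck_on k U f -> Ck_on k U g ->
  Ck_on k U (fun x => f x + g x).
Proof.
move=> oU; elim: k f g => [|k IHk] f g Cf Cg.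
  by split => // x Ux; exact: (continuousD (Ck_on_cont Cf Ux) (Ck_on_cont Cg Ux)).
split; first by
  move=> x Ux; exact: (continuousD (Ck_on_cont Cf Ux) (Ck_on_cont Cg Ux)).
move=> i; have [dfi Cdf] := Cf.2 i; have [dgi Cdg] := Cg.2 i; split.
  by move=> x Ux; apply: derivableD; [exact: dfi|exact: dgi].
apply: Ck_on_eq (IHk _ _ Cdf Cdg) => // x Ux.
by rewrite deriveD//; [exact: dfi|exact: dgi].
Qed.

Lemma Ck_onM k U f g : open U -> Ck_on k U f -> Ck_on k U g ->
  Ck_on k U (fun x => f x * g x).
Proof.
move=> oU; elim: k f g => [|k IHk] f g Cf Cg.
  by split => // x Ux; exact: (continuousM (Ck_on_cont Cf Ux) (Ck_on_cont Cg Ux)).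
split; first by
  move=> x Ux; exact: (continuousM (Ck_on_cont Cf Ux) (Ck_on_cont Cg Ux)).
move=> i; have [dfi Cdf] := Cf.2 i; have [dgi Cdg] := Cg.2 i; split.
  by move=> x Ux; apply: derivableM; [exact: dfi|exact: dgi].
have C1 := IHk _ _ (Ck_on_pred Cf) Cdg.
have C2 := IHk _ _ (Ck_on_pred Cg) Cdf.
apply: Ck_on_eq (Ck_onD oU C1 C2) => // x Ux.
by rewrite (deriveM (dfi _ Ux) (dgi _ Ux)).
Qed.

End EuclideanSmoothness.

(* An atlas stands for the maximal atlas that it generates. *)
Record manifold (R : realType) (n : nat) := Manifold {
  carrier :> topologicalType;
  manifold_hausdorff : hausdorff_space carrier;
  manifold_second_countable : @second_countable carrier;
  chart_index : Type;
  chart_dom : chart_index -> set carrier;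
  chart_cod : chart_index -> set 'rV[R]_n;
  chart : chart_index -> carrier -> 'rV[R]_n;
  chart_inv : chart_index -> 'rV[R]_n -> carrier;
  chart_dom_open : forall a, open (chart_dom a);
  chart_cod_open : forall a, open (chart_cod a);
  chart_cover : forall p, exists a, chart_dom a p;
  chart_homo : forall a p, chart_dom a p -> chart_cod a (chart a p);
  chart_inv_homo : forall a x, chart_cod a x -> chart_dom a (chart_inv a x);
  chartK : forall a p, chart_dom a p -> chart_inv a (chart a p) = p;
  chart_invK : forall a x, chart_cod a x -> chart a (chart_inv a x) = x;
  chart_continuous : forall a p,
    chart_dom a p -> {for p, continuous (chart a)};
  chart_inv_continuous : forall a x,
    chart_cod a x -> {for x, continuous (chart_inv a)};
  transition_smooth : forall a b (l : 'I_n),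
    Cinfty_on (chart_cod a `&` chart_inv a @^-1` chart_dom b)
      (fun x => chart b (chart_inv a x) 0 l)
}.

Section SmoothFunctions.
Context {R : realType} {n : nat} {M : manifold R n}.
Implicit Types (U : set M) (f g : M -> R).

Definition smooth_on U f : Prop := forall a : chart_index M,
  Cinfty_on (chart_cod a `&` chart_inv a @^-1` U) (f \o chart_inv a).

Lemma open_chart_image (a : chart_index M) U : open U ->
  open (chart_cod a `&` chart_inv a @^-1` U).
Proof.
move=> oU; rewrite openE => x [cx Ux]; apply: filterI.
  by apply: open_nbhs_nbhs; split => //; exact: chart_cod_open.
apply: (chart_inv_continuous cx).
by apply: open_nbhs_nbhs; split.
Qed.

Lemma smooth_onW U V f : V `<=` U -> smooth_on U f -> smooth_on V f.
Proof.
move=> VU sf a k; apply: Ck_onW (sf a k) => x [cx Vx].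
by split => //; exact: VU.
Qed.

Lemma smooth_on_eq U f g : open U -> (forall p, U p -> f p = g p) ->
  smooth_on U f -> smooth_on U g.
Proof.
move=> oU fg sf a k; apply: Ck_on_eq (sf a k); first exact: open_chart_image.
by move=> x [_ Ux]; exact: fg.
Qed.

Lemma smooth_on_cst U (c : R) : open U -> smooth_on U (fun=> c).
Proof. by move=> oU a k; apply: Ck_on_cst; exact: open_chart_image. Qed.

Lemma smooth_onD U f g : open U -> smooth_on U f -> smooth_on U g ->
  smooth_on U (fun p => f p + g p).
Proof.
by move=> oU sf sg a k; apply: Ck_onD;
  [exact: open_chart_image|exact: sf|exact: sg].
Qed.

Lemma smooth_onM U f g : open U -> smooth_on U f -> smooth_on U g ->
  smooth_on U (fun p => f p * g p).
Proof.
by move=> oU sf sg a k; apply: Ck_onM;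
  [exact: open_chart_image|exact: sf|exact: sg].
Qed.

Lemma smooth_on_sum U (I : Type) (r : seq I) (F : I -> M -> R) : open U ->
  (forall i, smooth_on U (F i)) -> smooth_on U (fun p => \sum_(i <- r) F i p).
Proof.
move=> oU sF; elim: r => [|i r IHr].
  have -> : (fun p => \sum_(i <- [::]) F i p) = fun=> 0 by
    apply/funext => p; rewrite big_nil.
  exact: smooth_on_cst.
have -> : (fun p => \sum_(j <- i :: r) F j p) =
    fun p => F i p + \sum_(j <- r) F j p by
  apply/funext => p; rewrite big_cons.
exact: smooth_onD.
Qed.

End SmoothFunctions.

Section Omega0.
Context {R : realType} {n : nat}.
Variable M : manifold R n.

Definition smooth_pred : {pred (M -> R)} :=
  fun f => `[< smooth_on setT f >].

Record Omega0 := MkOmega0 {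
  Omega0_val :> M -> R;
  _ : Omega0_val \in smooth_pred
}.
HB.instance Definition _ := [isSub for Omega0_val].
HB.instance Definition _ := [Choice of Omega0 by <:].

Lemma smooth_pred_subring : subring_closed smooth_pred.
Proof.
split=> [|f g /asboolP sf /asboolP sg|f g /asboolP sf /asboolP sg];
  apply/asboolP.
- by apply: smooth_on_cst; exact: openT.
- have -> : f - g = fun p => f p + (-1) * g p.
    by apply/funext => p; rewrite mulN1r.
  apply: smooth_onD (openT) sf _; apply: smooth_onM (openT) _ sg.
  exact: smooth_on_cst openT.
- exact: (smooth_onM openT sf sg).
Qed.
HB.instance Definition _ :=
  GRing.SubChoice_isSubComPzRing.Build (M -> R) smooth_pred Omega0
    smooth_pred_subring.

(* The R-vector space structure of an Omega0-module is the one obtained by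
   restricting scalars to the constant functions. *)
Lemma smooth_cst_proof (c : R) : (fun _ : M => c) \in smooth_pred.
Proof. by apply/asboolP; apply: smooth_on_cst; exact: openT. Qed.
Definition Omega0_cst (c : R) : Omega0 := MkOmega0 (smooth_cst_proof c).

Lemma Omega0_smooth (f : Omega0) (U : set M) : smooth_on U f.
Proof. by apply: (@smooth_onW _ _ _ setT) => //; case: f => f /= /asboolP. Qed.

End Omega0.

Section TensorProduct.
Context {A : comPzRingType}.
Variables U V : lmodType A.

(* The tensor product over A of two A-modules: formal sums of pairs modulo the
   congruence generated by biadditivity and (a u, v) ~ (u, a v). *)
Inductive tensor_rel : seq (U * V) -> seq (U * V) -> Prop :=
| tr_refl s : tensor_rel s s
| tr_sym s t : tensor_rel s t -> tensor_rel t s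
| tr_trans s t r : tensor_rel s t -> tensor_rel t r -> tensor_rel s r
| tr_cat s s' t t' :
    tensor_rel s s' -> tensor_rel t t' -> tensor_rel (s ++ t) (s' ++ t')
| tr_comm s t : tensor_rel (s ++ t) (t ++ s)
| tr_zero v : tensor_rel [:: (0, v)] [::]
| tr_addl u u' v : tensor_rel [:: (u + u', v)] [:: (u, v); (u', v)]
| tr_addr u v v' : tensor_rel [:: (u, v + v')] [:: (u, v); (u, v')]
| tr_scale a u v : tensor_rel [:: (a *: u, v)] [:: (u, a *: v)].

Definition tensor_relb : rel (seq (U * V)) := fun s t => `[< tensor_rel s t >].

Lemma tensor_relb_equiv : equiv_class_of tensor_relb.
Proof.
split=> [s|s t|t s r].
- by apply/asboolP; exact: tr_refl.
- by apply/asboolP/asboolP; exact: tr_sym.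
- by move=> /asboolP st /asboolP tr; apply/asboolP; exact: tr_trans st tr.
Qed.
Canonical tensor_equiv := EquivRelPack tensor_relb_equiv.

Definition tensor := {eq_quot tensor_equiv}.
HB.instance Definition _ := Choice.on tensor.
HB.instance Definition _ := EqQuotient.on tensor.

Definition sumt (s : seq (U * V)) : tensor := \pi_tensor s.

Lemma sumtP s t : sumt s = sumt t <-> tensor_rel s t.
Proof.
split; first by move=> /eqmodP/asboolP.
by move=> st; apply/eqmodP/asboolP.
Qed.

Lemma sumtK (t : tensor) : sumt (repr t) = t.
Proof. exact: reprK. Qed.

Lemma tensorW (Q : tensor -> Prop) : (forall s, Q (sumt s)) -> forall t, Q t.
Proof. by move=> h t; rewrite -(sumtK t). Qed.

Definition addt (s t : tensor) : tensor := sumt (repr s ++ repr t).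
Definition oppt (s : tensor) : tensor :=
  sumt [seq (- x.1, x.2) | x <- repr s].
Definition scalet (a : A) (s : tensor) : tensor :=
  sumt [seq (a *: x.1, x.2) | x <- repr s].

Lemma repr_sumt s : tensor_rel (repr (sumt s)) s.
Proof. by apply/sumtP; rewrite sumtK. Qed.

Lemma addtE s t : addt (sumt s) (sumt t) = sumt (s ++ t).
Proof. by apply/sumtP; apply: tr_cat; exact: repr_sumt. Qed.

Lemma tensor_rel_mapl (h : U -> U) : (forall u u', h (u + u') = h u + h u') ->
    (forall a u, h (a *: u) = a *: h u) ->
  forall s t, tensor_rel s t ->
    tensor_rel [seq (h x.1, x.2) | x <- s] [seq (h x.1, x.2) | x <- t].
Proof.
move=> hD hZ s t; elim=> {s t}.
- by move=> s; exact: tr_refl.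
- by move=> s t _; exact: tr_sym.
- by move=> s t r _ st _ tr; exact: tr_trans st tr.
- by move=> s s' t t' _ ss' _ tt'; rewrite !map_cat; exact: tr_cat.
- by move=> s t; rewrite !map_cat; exact: tr_comm.
- move=> v /=; have -> : h 0 = 0 by have := hZ 0 0; rewrite !scale0r.
  exact: tr_zero.
- by move=> u u' v /=; rewrite hD; exact: tr_addl.
- by move=> u v v' /=; exact: tr_addr.
- by move=> a u v /=; rewrite hZ; exact: tr_scale.
Qed.

Lemma opptE s : oppt (sumt s) = sumt [seq (- x.1, x.2) | x <- s].
Proof.
apply/sumtP; apply: (@tensor_rel_mapl -%R) (repr_sumt s) => *.
  by rewrite opprD.
by rewrite scalerN.
Qed.

Lemma scaletE a s : scalet a (sumt s) = sumt [seq (a *: x.1, x.2) | x <- s].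
Proof.
apply/sumtP; apply: (@tensor_rel_mapl ( *:%R a)) (repr_sumt s) => *.
  by rewrite scalerDr.
by rewrite !scalerA mulrC.
Qed.

Lemma addtA : associative addt.
Proof.
elim/tensorW=> s; elim/tensorW=> t; elim/tensorW=> r.
by rewrite !addtE catA.
Qed.

Lemma addtC : commutative addt.
Proof.
elim/tensorW=> s; elim/tensorW=> t.
by rewrite !addtE; apply/sumtP; exact: tr_comm.
Qed.

Lemma add0t : left_id (sumt [::]) addt.
Proof. by elim/tensorW=> s; rewrite addtE. Qed.

Lemma addNt : left_inverse (sumt [::]) oppt addt.
Proof.
elim/tensorW; elim=> [|[u v] s IHs]; first by rewrite opptE addtE.
move: IHs; rewrite !opptE !addtE /= => /sumtP IHs; apply/sumtP.
rewrite -cat1s -[X in _ ++ X]cat0s.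
apply: tr_trans (_ : tensor_rel (([:: (- u, v)] ++ [:: (u, v)]) ++
  ([seq (- x.1, x.2) | x <- s] ++ s)) _).
  rewrite -cat1s -[(u, v) :: s]cat1s -!catA; apply: tr_cat; first exact: tr_refl.
  by rewrite !catA; apply: tr_cat; [exact: tr_comm|exact: tr_refl].
rewrite -[[::]]/([::] ++ [::]); apply: tr_cat => //.
apply: tr_trans (tr_zero v).
by rewrite -(addNr u); apply: tr_sym; exact: tr_addl.
Qed.

HB.instance Definition _ := GRing.isZmodule.Build tensor addtA addtC add0t addNt.

Lemma sumt_cat s t : sumt (s ++ t) = sumt s + sumt t.
Proof. by rewrite [RHS]addtE. Qed.

Lemma scaletA a b t : scalet a (scalet b t) = scalet (a * b) t.
Proof.
elim/tensorW: t => s; rewrite !scaletE; congr sumt.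
by rewrite -map_comp; apply: eq_map => -[u v] /=; rewrite scalerA.
Qed.

Lemma scale1t : left_id 1 scalet.
Proof.
elim/tensorW=> s; rewrite scaletE; congr sumt.
by rewrite -[RHS]map_id; apply: eq_map => -[u v] /=; rewrite scale1r.
Qed.

Lemma scaletDr : right_distributive scalet +%R.
Proof.
move=> a; elim/tensorW=> s; elim/tensorW=> t.
by rewrite -sumt_cat !scaletE map_cat sumt_cat.
Qed.

Lemma scaletDl t : {morph scalet^~ t : a b / a + b}.
Proof.
move=> a b; elim/tensorW: t; elim=> [|[u v] s IHs].
  by rewrite !scaletE /= addr0.
rewrite -cat1s sumt_cat !scaletDr IHs addrACA; congr (_ + _).
by rewrite !scaletE /= -sumt_cat /= scalerDl; apply/sumtP; exact: tr_addl.
Qed.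

HB.instance Definition _ := GRing.Zmodule_isLmodule.Build A tensor
  scaletA scale1t scaletDr scaletDl.

Definition tens (u : U) (v : V) : tensor := sumt [:: (u, v)].

Lemma tensDl u u' v : tens (u + u') v = tens u v + tens u' v.
Proof. by rewrite /tens -sumt_cat; apply/sumtP; exact: tr_addl. Qed.

Lemma tensDr u v v' : tens u (v + v') = tens u v + tens u v'.
Proof. by rewrite /tens -sumt_cat; apply/sumtP; exact: tr_addr. Qed.

Lemma tensZl a u v : tens (a *: u) v = a *: tens u v.
Proof. by rewrite /tens [RHS]scaletE. Qed.

Lemma tensNl u v : tens (- u) v = - tens u v.
Proof. by rewrite -scaleN1r tensZl scaleN1r. Qed.

Lemma tensZr a u v : tens u (a *: v) = a *: tens u v.
Proof. by rewrite -tensZl /tens; apply/sumtP; apply: tr_sym; exact: tr_scale. Qed.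

Lemma tensor_ind (Q : tensor -> Prop) : Q 0 ->
  (forall u v t, Q t -> Q (tens u v + t)) -> forall t, Q t.
Proof.
move=> Q0 QD; elim/tensorW; elim=> [|[u v] s IHs]; first exact: Q0.
by rewrite -cat1s sumt_cat; exact: QD.
Qed.

(* The additive map determined by its values f u v on the generators u ⊗ v;
   the value on t does not depend on the representative chosen whenever f is
   balanced, see tensor_liftE and tensor_liftD. *)
Definition tensor_lift (W : zmodType) (f : U -> V -> W) (t : tensor) : W :=
  \sum_(x <- repr t) f x.1 x.2.

Definition balanced (W : zmodType) (f : U -> V -> W) : Prop :=
  [/\ forall u u' v, f (u + u') v = f u v + f u' v,
      forall u v v', f u (v + v') = f u v + f u v' &
      forall a u v, f (a *: u) v = f u (a *: v)].

Section Lift.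
Context {W : zmodType} {f : U -> V -> W}.
Hypothesis fP : balanced f.

Let lift_sumt s : tensor_lift f (sumt s) = \sum_(x <- s) f x.1 x.2.
Proof.
have [fDl fDr fZ] := fP; rewrite /tensor_lift.
have := repr_sumt s; move: (repr _) => t; elim=> {s t}.
- by [].
- by [].
- by move=> s t r _ -> _ ->.
- by move=> s s' t t' _ ss' _ tt'; rewrite !big_cat /= ss' tt'.
- by move=> s t; rewrite !big_cat /= addrC.
- move=> v; rewrite big_seq1 big_nil /=.
  by apply: (addrI (f 0 v)); rewrite -fDl !addr0.
- by move=> u u' v; rewrite !big_cons !big_nil /= fDl !addr0.
- by move=> u v v'; rewrite !big_cons !big_nil /= fDr !addr0.
- by move=> a u v; rewrite !big_cons !big_nil /= fZ.
Qed.

Lemma tensor_liftE u v : tensor_lift f (tens u v) = f u v.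
Proof. by rewrite lift_sumt big_seq1. Qed.

Lemma tensor_liftD : {morph tensor_lift f : s t / s + t}.
Proof.
elim/tensorW=> s; elim/tensorW=> t.
by rewrite -sumt_cat !lift_sumt big_cat.
Qed.

End Lift.

End TensorProduct.

Notation "u ⊗ v" := (tens u v) (at level 40, left associativity) : ring_scope.

Section VectorFields.
Context {R : realType} {n : nat}.
Variable M : manifold R n.
Notation C := (Omega0 M).

Definition derivation_pred : {pred (C -> C^o)} := fun D =>
  `[< [/\ forall f g, D (f + g) = D f + D g,
          forall (c : R) f, D (Omega0_cst M c * f) = Omega0_cst M c * D f &
          forall f g : C, D (f * g) = D f * g + f * D g] >].

(* A smooth vector field is identified with its action f |-> X f, an R-linear
   derivation of the ring of smooth functions; [X, Y] is then the commutator. *)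
Record vector_field := VectorField {
  vector_field_val : C -> C^o;
  _ : vector_field_val \in derivation_pred
}.
HB.instance Definition _ := [isSub for vector_field_val].
HB.instance Definition _ := [Choice of vector_field by <:].

Lemma derivation_submod : subsemimod_closed derivation_pred.
Proof.
split; first split=> [|D E /asboolP[D1 D2 D3] /asboolP[E1 E2 E3]].
- apply/asboolP; split=> [f g|c f|f g] /=.
  + by rewrite addr0.
  + by rewrite mulr0.
  + by rewrite mul0r mulr0 addr0.
- apply/asboolP; split=> [f g|c f|f g] /=.
  + by rewrite !fctE D1 E1 addrACA.
  + by rewrite !fctE D2 E2 mulrDr.
  + by rewrite !fctE D3 E3 mulrDl mulrDr addrACA.
- move=> a D /asboolP[D1 D2 D3]; apply/asboolP; split=> [f g|c f|f g] /=.
  + by rewrite !fctE D1 scalerDr.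
  + by rewrite !fctE D2 /GRing.scale/= mulrCA.
  + by rewrite !fctE D3 /GRing.scale/= mulrDr mulrA; congr (_ + _); rewrite mulrCA.
Qed.
HB.instance Definition _ :=
  GRing.SubChoice_isSubLmodule.Build C (C -> C^o) derivation_pred vector_field
    derivation_submod.

Definition vf_app (X : vector_field) : C -> C := vector_field_val X.
Coercion vf_app : vector_field >-> Funclass.

Implicit Types (X Y Z : vector_field) (f g : C).

Lemma vfD X f g : X (f + g) = X f + X g.
Proof. by rewrite /vf_app; case: X => D /= /asboolP[]. Qed.

Lemma vfM X f g : X (f * g) = X f * g + f * X g.
Proof. by rewrite /vf_app; case: X => D /= /asboolP[]. Qed.

Lemma vf_cst X c f : X (Omega0_cst M c * f) = Omega0_cst M c * X f.
Proof. by rewrite /vf_app; case: X => D /= /asboolP[]. Qed.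

Lemma vf_cst0 X c : X (Omega0_cst M c) = 0.
Proof.
have X1 : X 1 = 0.
  by apply: (addrI (X 1)); rewrite addr0 -[in RHS](mulr1 1) vfM mulr1 mul1r.
by rewrite -(mulr1 (Omega0_cst M c)) vf_cst X1 mulr0.
Qed.

Lemma vfB X f g : X (f - g) = X f - X g.
Proof. by have := vfD X (f - g) g; rewrite subrK => ->; rewrite addrK. Qed.

Lemma vf_addE X Y f : (X + Y) f = X f + Y f.
Proof. by []. Qed.

Lemma vf_scaleE a X f : (a *: X) f = a * X f.
Proof. by []. Qed.

Lemma vf_ext X Y : (forall f, X f = Y f) -> X = Y.
Proof. by move=> XY; apply/val_inj/funext. Qed.

Lemma bracket_proof X Y : ((fun f => X (Y f) - Y (X f)) : C -> C^o)
  \in derivation_pred.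
Proof.
apply/asboolP; split=> [f g|c f|f g].
- by rewrite !vfD addrACA opprD.
- by rewrite !vf_cst mulrBr.
- by rewrite !vfM !vfD !vfM; ring.
Qed.
Definition bracket X Y : vector_field := VectorField (bracket_proof X Y).

Lemma bracketE X Y f : bracket X Y f = X (Y f) - Y (X f).
Proof. by []. Qed.

Lemma bracket_linl a X Y Z :
  bracket (a *: X + Y) Z = a *: bracket X Z + (- Z a *: X + bracket Y Z).
Proof.
apply: vf_ext => f; rewrite !(bracketE, vf_addE, vf_scaleE) vfD vfM.
ring.
Qed.

Lemma bracket_linr a X Y Z :
  bracket X (a *: Y + Z) = a *: bracket X Y + (X a *: Y + bracket X Z).
Proof.
apply: vf_ext => f; rewrite !(bracketE, vf_addE, vf_scaleE) vfD vfM.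
ring.
Qed.

Lemma bracketXX X : bracket X X = 0.
Proof. by apply: vf_ext => f; rewrite bracketE subrr. Qed.

End VectorFields.

Section Forms.
Context {R : realType} {n : nat}.
Variable M : manifold R n.
Notation C := (Omega0 M).
Notation VF := (vector_field M).

Definition form1_pred : {pred (VF -> C^o)} := fun w =>
  `[< forall (a : C) X Y, w (a *: X + Y) = a * w X + w Y >].

(* A smooth k-form is identified with its action on smooth vector fields, an
   alternating Omega0-multilinear map (X_1, ..., X_k) |-> w(X_1, ..., X_k).
   The curvature of a pseudoconnection only involves k = 0, 1, 2. *)
Record Omega1 := MkOmega1 {
  Omega1_val : VF -> C^o;
  _ : Omega1_val \in form1_pred
}.
HB.instance Definition _ := [isSub for Omega1_val].
HB.instance Definition _ := [Choice of Omega1 by <:].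

Lemma form1_submod : subsemimod_closed form1_pred.
Proof.
split; first split=> [|v w /asboolP vl /asboolP wl].
- by apply/asboolP => a X Y /=; rewrite mulr0 addr0.
- apply/asboolP => a X Y; rewrite !fctE vl wl.
  by rewrite addrACA mulrDr.
- move=> b w /asboolP wl; apply/asboolP => a X Y; rewrite !fctE wl.
  by rewrite /GRing.scale/= mulrDr mulrCA.
Qed.
HB.instance Definition _ :=
  GRing.SubChoice_isSubLmodule.Build C (VF -> C^o) form1_pred Omega1
    form1_submod.

Definition Omega1_app (w : Omega1) : VF -> C := Omega1_val w.
Coercion Omega1_app : Omega1 >-> Funclass.

Definition form2_pred : {pred (VF -> VF -> C^o)} := fun w =>
  `[< [/\ forall (a : C) X Y Z, w (a *: X + Y) Z = a * w X Z + w Y Z,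
          forall (a : C) X Y Z, w X (a *: Y + Z) = a * w X Y + w X Z &
          forall X, w X X = 0] >].

Record Omega2 := MkOmega2 {
  Omega2_val : VF -> VF -> C^o;
  _ : Omega2_val \in form2_pred
}.
HB.instance Definition _ := [isSub for Omega2_val].
HB.instance Definition _ := [Choice of Omega2 by <:].

Lemma form2_submod : subsemimod_closed form2_pred.
Proof.
split; first split=> [|v w /asboolP[v1 v2 v3] /asboolP[w1 w2 w3]].
- by apply/asboolP; split=> [a X Y Z|a X Y Z|X] //=; rewrite mulr0 addr0.
- apply/asboolP; split=> [a X Y Z|a X Y Z|X]; rewrite !fctE.
  + by rewrite v1 w1 addrACA mulrDr.
  + by rewrite v2 w2 addrACA mulrDr.
  + by rewrite v3 w3 addr0.
- move=> b w /asboolP[w1 w2 w3]; apply/asboolP.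
  split=> [a X Y Z|a X Y Z|X]; rewrite !fctE /GRing.scale/=.
  + by rewrite w1 mulrDr mulrCA.
  + by rewrite w2 mulrDr mulrCA.
  + by rewrite w3 mulr0.
Qed.
HB.instance Definition _ :=
  GRing.SubChoice_isSubLmodule.Build C (VF -> VF -> C^o) form2_pred Omega2
    form2_submod.

Definition Omega2_app (w : Omega2) : VF -> VF -> C := Omega2_val w.
Coercion Omega2_app : Omega2 >-> Funclass.

Implicit Types (f g a : C) (w t : Omega1) (X Y Z : VF).

Lemma form1_lin w a X Y : w (a *: X + Y) = a * w X + w Y.
Proof. by rewrite /Omega1_app; case: w => w /= /asboolP. Qed.

Lemma form1_0 w : w 0 = 0.
Proof.
have := form1_lin w 1 0 0; rewrite scaler0 addr0 mul1r => w0.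
by apply: (addrI (w 0)); rewrite -w0 addr0.
Qed.

Lemma form1_addE w t X : (w + t) X = w X + t X. Proof. by []. Qed.
Lemma form1_scaleE a w X : (a *: w) X = a * w X. Proof. by []. Qed.
Lemma form2_addE (w t : Omega2) X Y : (w + t) X Y = w X Y + t X Y.
Proof. by []. Qed.
Lemma form2_scaleE a (w : Omega2) X Y : (a *: w) X Y = a * w X Y.
Proof. by []. Qed.

Lemma form2_ext (w t : Omega2) : (forall X Y, w X Y = t X Y) -> w = t.
Proof. by move=> wt; apply/val_inj/funext => X; apply/funext => Y; exact: wt. Qed.

Lemma ext_d0_proof f : ((fun X => X f) : VF -> C^o) \in form1_pred.
Proof. by apply/asboolP. Qed.
Definition ext_d0 f : Omega1 := MkOmega1 (ext_d0_proof f).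

Lemma ext_d1_proof w :
  ((fun X Y => X (w Y) - Y (w X) - w (bracket X Y)) : VF -> VF -> C^o)
  \in form2_pred.
Proof.
apply/asboolP; split=> [a X Y Z|a X Y Z|X].
- by rewrite bracket_linl !(form1_lin, vf_addE, vf_scaleE, vfD, vfM); ring.
- by rewrite bracket_linr !(form1_lin, vf_addE, vf_scaleE, vfD, vfM); ring.
- by rewrite bracketXX form1_0 subrr subr0.
Qed.
Definition ext_d1 w : Omega2 := MkOmega2 (ext_d1_proof w).

Lemma wedge_proof w t :
  ((fun X Y => w X * t Y - w Y * t X) : VF -> VF -> C^o) \in form2_pred.
Proof.
apply/asboolP; split=> [a X Y Z|a X Y Z|X].
- by rewrite !form1_lin; ring.
- by rewrite !form1_lin; ring.
- by rewrite mulrC subrr.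
Qed.
Definition wedge w t : Omega2 := MkOmega2 (wedge_proof w t).

Lemma ext_d0E f X : ext_d0 f X = X f. Proof. by []. Qed.
Lemma ext_d1E w X Y :
  ext_d1 w X Y = X (w Y) - Y (w X) - w (bracket X Y).
Proof. by []. Qed.
Lemma wedgeE w t X Y : wedge w t X Y = w X * t Y - w Y * t X.
Proof. by []. Qed.

Lemma wedgeDl w w' t : wedge (w + w') t = wedge w t + wedge w' t.
Proof.
by apply: form2_ext => X Y; rewrite form2_addE !wedgeE !form1_addE; ring.
Qed.

Lemma wedgeC w t : wedge w t = - wedge t w.
Proof.
rewrite -[RHS]scaleN1r; apply: form2_ext => X Y.
by rewrite form2_scaleE !wedgeE; ring.
Qed.

Lemma wedgeZl f w t : wedge (f *: w) t = f *: wedge w t.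
Proof.
by apply: form2_ext => X Y; rewrite form2_scaleE !wedgeE !form1_scaleE; ring.
Qed.

Lemma wedgeDr w t t' : wedge w (t + t') = wedge w t + wedge w t'.
Proof. by rewrite wedgeC wedgeDl opprD -!wedgeC. Qed.

Lemma wedgeZr f w t : wedge w (f *: t) = f *: wedge w t.
Proof. by rewrite wedgeC wedgeZl -scalerN -wedgeC. Qed.

Lemma ext_d1D w t : ext_d1 (w + t) = ext_d1 w + ext_d1 t.
Proof.
apply: form2_ext => X Y; rewrite form2_addE !ext_d1E !form1_addE !vfD.
ring.
Qed.

Lemma ext_d1Z f w : ext_d1 (f *: w) = wedge (ext_d0 f) w + f *: ext_d1 w.
Proof.
apply: form2_ext => X Y; rewrite form2_addE form2_scaleE wedgeE !ext_d1E.
rewrite !form1_scaleE !vfM !ext_d0E; ring.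
Qed.

Lemma wedge0l w : wedge 0 w = 0.
Proof. by rewrite -(scale0r (0 : Omega1)) wedgeZl scale0r. Qed.

Lemma ext_d0_cst c : ext_d0 (Omega0_cst M c) = 0.
Proof. by apply/val_inj/funext => X; exact: vf_cst0. Qed.

End Forms.

(* A smooth vector bundle of rank r, given by its fibres and an atlas of local
   trivialisations, linear on fibres, with smooth changes of frame; the smooth
   structure of the total space is the one making these diffeomorphisms. *)
Record vector_bundle (R : realType) (n : nat) (M : manifold R n) (r : nat) :=
VectorBundle {
  fiber : M -> lmodType R;
  triv_index : Type;
  triv_dom : triv_index -> set M;
  triv : triv_index -> forall p, {linear fiber p -> 'rV[R]_r};
  triv_inv : triv_index -> forall p, {linear 'rV[R]_r -> fiber p};
  triv_dom_open : forall i, open (triv_dom i);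
  triv_cover : forall p, exists i, triv_dom i p;
  trivK : forall i p, triv_dom i p -> cancel (triv i p) (triv_inv i p);
  triv_invK : forall i p, triv_dom i p -> cancel (triv_inv i p) (triv i p);
  frame_change_smooth : forall i j (k l : 'I_r),
    smooth_on (triv_dom i `&` triv_dom j)
      (fun p => triv j p (triv_inv i p (delta_mx 0 k)) 0 l)
}.

Section Sections.
Context {R : realType} {n r : nat} {M : manifold R n}.
Variable xi : vector_bundle M r.
Notation C := (Omega0 M).

Definition section_pred : {pred (forall p, fiber xi p)} := fun s =>
  `[< forall i (l : 'I_r),
        smooth_on (triv_dom i) (fun p => triv i p (s p) 0 l) >].

Record OmegaB0 := MkOmegaB0 {
  section_val :> forall p, fiber xi p;
  _ : section_val \in section_pred
}.
HB.instance Definition _ := [isSub for section_val].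
HB.instance Definition _ := [Choice of OmegaB0 by <:].

Implicit Types (s t : OmegaB0) (f g : C).

Lemma sec_smooth s i l :
  smooth_on (triv_dom i) (fun p => triv i p (s p) 0 l).
Proof. by case: s => s /= /asboolP. Qed.

Lemma sec_ext s t : (forall p, s p = t p) -> s = t.
Proof. by move=> st; apply/val_inj/functional_extensionality_dep. Qed.

Lemma sec0_proof : (fun=> 0) \in section_pred.
Proof.
apply/asboolP => i l; under eq_fun do rewrite linear0 mxE.
exact: smooth_on_cst (triv_dom_open i).
Qed.
Definition sec0 : OmegaB0 := MkOmegaB0 sec0_proof.

Lemma sec_add_proof s t : (fun p => s p + t p) \in section_pred.
Proof.
apply/asboolP => i l; under eq_fun do rewrite linearD mxE.
by apply: smooth_onD; [exact: triv_dom_open|exact: sec_smooth..].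
Qed.
Definition sec_add s t : OmegaB0 := MkOmegaB0 (sec_add_proof s t).

Lemma sec_scale_proof f s : (fun p => f p *: s p) \in section_pred.
Proof.
apply/asboolP => i l; under eq_fun do rewrite linearZ mxE.
apply: smooth_onM; [exact: triv_dom_open| |exact: sec_smooth].
exact: Omega0_smooth.
Qed.
Definition sec_scale f s : OmegaB0 := MkOmegaB0 (sec_scale_proof f s).

Definition sec_opp s : OmegaB0 := sec_scale (- 1) s.

Lemma sec_addA : associative sec_add.
Proof. by move=> s t u; apply: sec_ext => p; exact: addrA. Qed.
Lemma sec_addC : commutative sec_add.
Proof. by move=> s t; apply: sec_ext => p; exact: addrC. Qed.
Lemma sec_add0 : left_id sec0 sec_add.
Proof. by move=> s; apply: sec_ext => p; exact: add0r. Qed.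
Lemma sec_addN : left_inverse sec0 sec_opp sec_add.
Proof. by move=> s; apply: sec_ext => p /=; rewrite scaleN1r addNr. Qed.
HB.instance Definition _ :=
  GRing.isZmodule.Build OmegaB0 sec_addA sec_addC sec_add0 sec_addN.

Lemma sec_scaleA f g s : sec_scale f (sec_scale g s) = sec_scale (f * g) s.
Proof. by apply: sec_ext => p; exact: scalerA. Qed.
Lemma sec_scale1 : left_id 1 sec_scale.
Proof. by move=> s; apply: sec_ext => p; exact: scale1r. Qed.
Lemma sec_scaleDr : right_distributive sec_scale +%R.
Proof. by move=> f s t; apply: sec_ext => p; exact: scalerDr. Qed.
Lemma sec_scaleDl s : {morph sec_scale^~ s : f g / f + g}.
Proof. by move=> f g; apply: sec_ext => p; exact: scalerDl. Qed.
HB.instance Definition _ := GRing.Zmodule_isLmodule.Build C OmegaB0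
  sec_scaleA sec_scale1 sec_scaleDr sec_scaleDl.

(* OmegaBk is the module of k-forms with values in xi. *)
Definition OmegaB1 := tensor (Omega1 M) OmegaB0.
Definition OmegaB2 := tensor (Omega2 M) OmegaB0.
HB.instance Definition _ := GRing.Lmodule.on OmegaB1.
HB.instance Definition _ := GRing.Lmodule.on OmegaB2.

(* The bundle endomorphisms over the identity of M.  By the smoothness of the
   changes of frame, it is enough to ask for smooth matrix coefficients in
   each trivialisation. *)
Record HOM := MkHOM {
  hom_val : forall p, {linear fiber xi p -> fiber xi p};
  hom_smooth : forall i (k l : 'I_r), smooth_on (triv_dom i)
    (fun p => triv i p (hom_val p (triv_inv i p (delta_mx 0 k))) 0 l)
}.

Lemma hom_app_proof (P : HOM) s : (fun p => hom_val P p (s p)) \in section_pred.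
Proof.
apply/asboolP => i l.
apply: (@smooth_on_eq _ _ _ _ (fun p => \sum_(k < r) triv i p (s p) 0 k *
  triv i p (hom_val P p (triv_inv i p (delta_mx 0 k))) 0 l)).
- exact: triv_dom_open.
- move=> p pi; rewrite -[in RHS](trivK pi (s p)).
  rewrite [in RHS](row_sum_delta (triv i p (s p))) !linear_sum summxE.
  by apply: eq_bigr => k _; rewrite !linearZ mxE.
- apply: smooth_on_sum; first exact: triv_dom_open.
  move=> k; apply: smooth_onM; [exact: triv_dom_open|exact: sec_smooth|].
  exact: hom_smooth.
Qed.
Definition hom_app (P : HOM) s : OmegaB0 := MkOmegaB0 (hom_app_proof P s).

Lemma hom_appD (P : HOM) s t : hom_app P (s + t) = hom_app P s + hom_app P t.
Proof. by apply: sec_ext => p; exact: linearD. Qed.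

Lemma hom_appZ (P : HOM) f s : hom_app P (f *: s) = f *: hom_app P s.
Proof. by apply: sec_ext => p; exact: linearZ. Qed.

Definition hom_app1 (P : HOM) : OmegaB1 -> OmegaB1 :=
  tensor_lift (fun (w : Omega1 M) s => w ⊗ hom_app P s).
Definition hom_app2 (P : HOM) : OmegaB2 -> OmegaB2 :=
  tensor_lift (fun (w : Omega2 M) s => w ⊗ hom_app P s).

Definition wedgeB (w : Omega1 M) : OmegaB1 -> OmegaB2 :=
  tensor_lift (fun (t : Omega1 M) s => wedge w t ⊗ s).

Definition Ev1 (X : vector_field M) : OmegaB1 -> OmegaB0 :=
  tensor_lift (fun (w : Omega1 M) s => w X *: s).
Definition Ev2 (X Y : vector_field M) : OmegaB2 -> OmegaB0 :=
  tensor_lift (fun (w : Omega2 M) s => w X Y *: s).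

Lemma hom_app1_balanced (P : HOM) :
  balanced (fun (w : Omega1 M) s => w ⊗ hom_app P s).
Proof.
split=> [w w' s|w s s'|f w s]; first exact: tensDl.
  by rewrite hom_appD tensDr.
by rewrite hom_appZ tensZl tensZr.
Qed.

Lemma hom_app2_balanced (P : HOM) :
  balanced (fun (w : Omega2 M) s => w ⊗ hom_app P s).
Proof.
split=> [w w' s|w s s'|f w s]; first exact: tensDl.
  by rewrite hom_appD tensDr.
by rewrite hom_appZ tensZl tensZr.
Qed.

Lemma Ev1_balanced X : balanced (fun (w : Omega1 M) (s : OmegaB0) => w X *: s).
Proof.
split=> [w w' s|w s s'|f w s]; first exact: scalerDl.
  exact: scalerDr.
by rewrite scalerA mulrC.
Qed.

Lemma Ev2_balanced X Y :
  balanced (fun (w : Omega2 M) (s : OmegaB0) => w X Y *: s).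
Proof.
split=> [w w' s|w s s'|f w s]; first exact: scalerDl.
  exact: scalerDr.
by rewrite scalerA mulrC.
Qed.

Lemma wedgeB_balanced w :
  balanced (fun (t : Omega1 M) (s : OmegaB0) => wedge w t ⊗ s).
Proof.
split=> [t t' s|t s s'|f t s]; first by rewrite wedgeDr tensDl.
  exact: tensDr.
by rewrite wedgeZr tensZl tensZr.
Qed.

Lemma wedgeB_tens w (t : Omega1 M) (s : OmegaB0) : wedgeB w (t ⊗ s) = wedge w t ⊗ s.
Proof. exact: tensor_liftE (wedgeB_balanced w) t s. Qed.

Lemma wedgeBDr w (x y : OmegaB1) : wedgeB w (x + y) = wedgeB w x + wedgeB w y.
Proof. exact: tensor_liftD (wedgeB_balanced w) x y. Qed.

Lemma wedgeB0 w : wedgeB w 0 = 0.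
Proof. by apply: (addrI (wedgeB w 0)); rewrite -wedgeBDr !addr0. Qed.

Lemma wedgeBDl (w w' : Omega1 M) (x : OmegaB1) :
  wedgeB (w + w') x = wedgeB w x + wedgeB w' x.
Proof.
move: x; apply: tensor_ind => [|t s x IHx]; first by rewrite !wedgeB0 addr0.
by rewrite !wedgeBDr IHx !wedgeB_tens wedgeDl tensDl addrACA.
Qed.

Lemma wedgeBZl f (w : Omega1 M) (x : OmegaB1) : wedgeB (f *: w) x = f *: wedgeB w x.
Proof.
move: x; apply: tensor_ind => [|t s x IHx]; first by rewrite !wedgeB0 scaler0.
by rewrite !wedgeBDr IHx !wedgeB_tens wedgeZl tensZl scalerDr.
Qed.

Lemma wedgeBZr f (w : Omega1 M) (x : OmegaB1) : wedgeB w (f *: x) = f *: wedgeB w x.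
Proof.
move: x; apply: tensor_ind => [|t s x IHx]; first by rewrite scaler0 !wedgeB0 scaler0.
by rewrite scalerDr !wedgeBDr IHx -tensZl !wedgeB_tens wedgeZr tensZl scalerDr.
Qed.

End Sections.

Coercion hom_app : HOM >-> Funclass.

Record pseudoconnection (R : realType) (n r : nat) (M : manifold R n)
  (xi : vector_bundle M r) (P : HOM xi) := Pseudoconnection {
  nabla_val :> OmegaB0 xi -> OmegaB1 xi;
  nablaD : forall s t, nabla_val (s + t) = nabla_val s + nabla_val t;
  nablaZ : forall (c : R) s,
    nabla_val (Omega0_cst M c *: s) = Omega0_cst M c *: nabla_val s;
  nabla_leibniz : forall (f : Omega0 M) s,
    nabla_val (f *: s) = ext_d0 f ⊗ P s + f *: nabla_val s
}.

Section Curvature.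
Context {R : realType} {n r : nat} {M : manifold R n} {xi : vector_bundle M r}.
Context {P : HOM xi}.
Variable nabla : pseudoconnection P.

(* The exterior derivative of nabla is nabla in degree 0 and dnabla1 in
   degree 1, where (-1)^k = -1; these are the degrees the curvature needs. *)
Definition dnabla1 : OmegaB1 xi -> OmegaB2 xi :=
  tensor_lift (fun (w : Omega1 M) s => ext_d1 w ⊗ P s - wedgeB w (nabla s)).

Lemma dnabla1_balanced : balanced
  (fun (w : Omega1 M) s => ext_d1 w ⊗ P s - wedgeB w (nabla s)).
Proof.
split=> [w w' s|w s s'|f w s].
- by rewrite ext_d1D tensDl wedgeBDl opprD addrACA.
- by rewrite hom_appD tensDr nablaD wedgeBDr opprD addrACA.
- rewrite ext_d1Z nabla_leibniz wedgeBDr wedgeB_tens hom_appZ wedgeBZl wedgeBZr.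
  by rewrite tensDl tensZl tensZr (wedgeC w) tensNl opprD opprK addrCA addrA.
Qed.

Lemma dnabla1_tens w (s : OmegaB0 xi) :
  dnabla1 (w ⊗ s) = ext_d1 w ⊗ P s - wedgeB w (nabla s).
Proof. exact: tensor_liftE dnabla1_balanced w s. Qed.

Lemma dnabla1D (x y : OmegaB1 xi) : dnabla1 (x + y) = dnabla1 x + dnabla1 y.
Proof. exact: tensor_liftD dnabla1_balanced x y. Qed.

Lemma dnabla1_cst (c : R) (x : OmegaB1 xi) :
  dnabla1 (Omega0_cst M c *: x) = Omega0_cst M c *: dnabla1 x.
Proof.
have dnabla10 : dnabla1 0 = 0.
  by apply: (addrI (dnabla1 0)); rewrite -dnabla1D !addr0.
move: x; apply: tensor_ind => [|w s x IHx]; first by rewrite scaler0 dnabla10 scaler0.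
rewrite scalerDr !dnabla1D IHx -tensZl !dnabla1_tens scalerDr scalerBr.
by rewrite ext_d1Z ext_d0_cst wedge0l add0r tensZl wedgeBZl.
Qed.

Definition curvature (s : OmegaB0 xi) : OmegaB2 xi :=
  hom_app2 P (dnabla1 (nabla s)) - dnabla1 (hom_app1 P (nabla s))
  + dnabla1 (nabla (P s)).

Definition nabla_at (X : vector_field M) (s : OmegaB0 xi) : OmegaB0 xi :=
  Ev1 X (nabla s).

Definition curvature_at (X Y : vector_field M) (s : OmegaB0 xi) : OmegaB0 xi :=
  Ev2 X Y (curvature s).

End Curvature.

(* Main.v *)
(* The key identity is the Cartan-type formula
     Ev_{X,Y} (d^nabla x) =
       nabla_X (Ev_Y x) - nabla_Y (Ev_X x) - P (Ev_{[X,Y]} x)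
   for all 1-forms x with values in xi. Both sides are additive in x, so it
   suffices to check it on generators, where it is the Leibniz rule.
   Applied to x = nabla s, P (nabla s) and nabla (P s), it gives the theorem,
   the two terms P (P (nabla_[X,Y] s)) cancelling. *)
Require Import Defs.
From mathcomp Require Import all_boot all_order all_algebra.
From mathcomp Require Import all_classical all_reals all_analysis.

Set Implicit Arguments.
Unset Strict Implicit.
Unset Printing Implicit Defensive.

Import GRing.Theory.

Local Open Scope ring_scope.

Lemma morph_add0 (U V : zmodType) (f : U -> V) : {morph f : x y / x + y} -> f 0 = 0.
Proof. by move=> fD; apply: (addrI (f 0)); rewrite -fD !addr0. Qed.

(** Every tensor is a finite sum of generators. Only additivity is assumed, since [dnabla1] and
    [nabla_at] obey a Leibniz rule and so are not linear over smooth functions in general. *)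
Lemma tensor_morph_ext (A : comPzRingType) (U V : lmodType A) (W : zmodType)
    (f g : tensor U V -> W) :
  {morph f : x y / x + y} -> {morph g : x y / x + y} ->
  (forall u v, f (u ⊗ v) = g (u ⊗ v)) -> f =1 g.
Proof.
move=> fD gD fg; apply: tensor_ind => [|u v t IHt]; first by rewrite !morph_add0.
by rewrite fD gD fg IHt.
Qed.

Section EvaluationOfForms.
Context {R : realType} {n r : nat} {M : manifold R n} {xi : vector_bundle M r}.
Implicit Types (X Y : vector_field M) (s t : OmegaB0 xi).
Implicit Types (x y : OmegaB1 xi) (u v : OmegaB2 xi) (P : HOM xi).

Lemma hom_appB P s t : P (s - t) = P s - P t.
Proof. by rewrite hom_appD -scaleN1r hom_appZ scaleN1r. Qed.

Lemma Ev1_tens X (w : Omega1 M) s : Ev1 X (w ⊗ s) = w X *: s.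
Proof. exact: tensor_liftE (Ev1_balanced xi X) w s. Qed.

Lemma Ev1D X x y : Ev1 X (x + y) = Ev1 X x + Ev1 X y.
Proof. exact: tensor_liftD (Ev1_balanced xi X) x y. Qed.

Lemma Ev1Z X f x : Ev1 X (f *: x) = f *: Ev1 X x.
Proof.
move: x; apply: tensor_morph_ext => [x y|x y|w s].
- by rewrite scalerDr Ev1D.
- by rewrite Ev1D scalerDr.
- by rewrite -tensZl !Ev1_tens form1_scaleE scalerA.
Qed.

Lemma Ev2_tens X Y (w : Omega2 M) s : Ev2 X Y (w ⊗ s) = w X Y *: s.
Proof. exact: tensor_liftE (Ev2_balanced xi X Y) w s. Qed.

Lemma Ev2D X Y u v : Ev2 X Y (u + v) = Ev2 X Y u + Ev2 X Y v.
Proof. exact: tensor_liftD (Ev2_balanced xi X Y) u v. Qed.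

Lemma Ev2B X Y u v : Ev2 X Y (u - v) = Ev2 X Y u - Ev2 X Y v.
Proof. by apply/eqP; rewrite eq_sym subr_eq -Ev2D subrK. Qed.

(** Evaluation acts on the form factor and [P] on the section factor; they commute because [P] is
    linear over smooth functions. *)
Lemma Ev1_hom_app P X x : Ev1 X (hom_app1 P x) = P (Ev1 X x).
Proof.
move: x; apply: tensor_morph_ext => [x y|x y|w s].
- by rewrite /hom_app1 (tensor_liftD (hom_app1_balanced P)) Ev1D.
- by rewrite Ev1D hom_appD.
- by rewrite /hom_app1 (tensor_liftE (hom_app1_balanced P)) !Ev1_tens hom_appZ.
Qed.

Lemma Ev2_hom_app P X Y u : Ev2 X Y (hom_app2 P u) = P (Ev2 X Y u).
Proof.
move: u; apply: tensor_morph_ext => [u v|u v|w s].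
- by rewrite /hom_app2 (tensor_liftD (hom_app2_balanced P)) Ev2D.
- by rewrite Ev2D hom_appD.
- by rewrite /hom_app2 (tensor_liftE (hom_app2_balanced P)) !Ev2_tens hom_appZ.
Qed.

(** Taken at [x = nabla s], this gives the part of [dnabla1] that differentiates the section. *)
Lemma Ev2_wedgeB X Y (w : Omega1 M) x :
  Ev2 X Y (wedgeB w x) = w X *: Ev1 Y x - w Y *: Ev1 X x.
Proof.
move: x; apply: tensor_morph_ext => [x y|x y|t s].
- by rewrite wedgeBDr Ev2D.
- by rewrite !Ev1D !scalerDr opprD addrACA.
- by rewrite wedgeB_tens Ev2_tens !Ev1_tens wedgeE scalerBl !scalerA.
Qed.

End EvaluationOfForms.

Section EvaluationOfConnection.
Context {R : realType} {n r : nat} {M : manifold R n} {xi : vector_bundle M r}.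
Context {P : HOM xi}.
Variable nabla : pseudoconnection P.
Implicit Types (X Y : vector_field M) (s t : OmegaB0 xi).

Lemma nabla_atD X s t :
  nabla_at nabla X (s + t) = nabla_at nabla X s + nabla_at nabla X t.
Proof. by rewrite /nabla_at nablaD Ev1D. Qed.

Lemma nabla_at_leibniz X (f : Omega0 M) s :
  nabla_at nabla X (f *: s) = X f *: P s + f *: nabla_at nabla X s.
Proof. by rewrite /nabla_at nabla_leibniz Ev1D Ev1_tens Ev1Z. Qed.

Lemma Ev2_dnabla1 X Y (x : OmegaB1 xi) :
  Ev2 X Y (dnabla1 nabla x) =
    nabla_at nabla X (Ev1 Y x) - nabla_at nabla Y (Ev1 X x)
    - P (Ev1 (bracket X Y) x).
Proof.
move: x; apply: tensor_morph_ext => [x y|x y|w s].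
- by rewrite dnabla1D Ev2D.
- rewrite !Ev1D !nabla_atD hom_appD !opprD.
  by rewrite [RHS]addrACA; congr (_ + _); rewrite addrACA.
(* The Leibniz rule turns [nabla_at nabla X (w Y *: s)] into [X (w Y) *: P s + w Y *: nabla_at nabla
   X s]. With its counterpart for [Y] and the bracket term, the multiples of [P s] add up to the
   value of [ext_d1 w], and the rest is minus that of [wedgeB w (nabla s)]. *)
- rewrite dnabla1_tens Ev2B Ev2_tens Ev2_wedgeB ext_d1E !Ev1_tens.
  rewrite !nabla_at_leibniz hom_appZ !scalerBl !opprB !opprD.
  by rewrite [LHS]addrAC [in RHS]addrACA.
Qed.

End EvaluationOfConnection.

Theorem theorem2p9 (R : realType) (n r : nat) (M : manifold R n)
    (xi : vector_bundle M r) (P : HOM xi) (nabla : pseudoconnection P)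
    (X Y : vector_field M) (s : OmegaB0 xi) :
  curvature_at nabla X Y s =
    nabla_at nabla X (nabla_at nabla Y (P s)) - nabla_at nabla Y (nabla_at nabla X (P s))
    - nabla_at nabla X (P (nabla_at nabla Y s)) + P (nabla_at nabla X (nabla_at nabla Y s))
    + nabla_at nabla Y (P (nabla_at nabla X s)) - P (nabla_at nabla Y (nabla_at nabla X s))
    - P (nabla_at nabla (bracket X Y) (P s)).
Proof.
rewrite /curvature_at /curvature Ev2D Ev2B Ev2_hom_app !Ev2_dnabla1 !Ev1_hom_app.
rewrite !hom_appB.
(* The first [opprB] puts the double [P] term of the second summand next to its opposite in the
   first, where [subrK] cancels them. *)
rewrite opprB (addrA _ (P (P _))) subrK opprB !addrA.
(* Of the seven remaining terms, 1 and 2 come from [hom_app2 P (dnabla1 (nabla s))], 3 and 4 from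
   the subtracted summand, and 5 to 7 from [dnabla1 (nabla (P s))]. *)
by rewrite [LHS](ACl (5*6*4*1*3*2*7)).
Qed.
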